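(* Let $m \ge n \ge 2$ and let $L : M_{m,n} \to M_{m,n}$ be an invertible linear map such that (1) $L(S(\mathbb{R}^n_+,\mathbb{R}^m_+)) \subset S(\mathbb{R}^n_+,\mathbb{R}^m_+)$, and (2) $\operatorname{rank}(L(A)) = 1$ whenever $\operatorname{rank}(A) = 1$ and $A \in S(\mathbb{R}^n_+,\mathbb{R}^m_+)$. Then there exist an invertible row positive matrix $X \in M_m$ and an inverse nonnegative matrix $Y \in M_n$ such that $L(A) = XAY$ for all $A \in M_{m,n}$.
   Context: $M_{m,n}$ is the space of real $m\times n$ matrices and $M_n = M_{n,n}$. $\mathbb{R}^n_+$ is the nonnegative orthant in $\mathbb{R}^n$. A matrix $A\in M_{m,n}$ is semipositive if there is $x \in \mathbb{R}^n$ with $x>0$ and $Ax>0$ (componentwise strict inequalities); $S(\mathbb{R}^n_+,\mathbb{R}^m_+)$ denotes the set of all semipositive $m\times n$ matrices. A matrix is row positive if it is entrywise nonnegative and every row contains at least one nonzero entry. A square matrix $Y$ is inverse nonnegative if it is invertible and $Y^{-1}$ is entrywise nonnegative. *)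

(* Defs.v *)
From HB Require Import structures.
From mathcomp Require Import all_boot all_order all_algebra.
From mathcomp Require Import reals.

Set Implicit Arguments.
Unset Strict Implicit.
Unset Printing Implicit Defensive.

Import Order.TTheory GRing.Theory Num.Theory.

Local Open Scope ring_scope.

Definition mx_pos (R : numDomainType) (m n : nat) (A : 'M[R]_(m, n)) : Prop :=
  forall i j, 0 < A i j.

Definition mx_nonneg (R : numDomainType) (m n : nat) (A : 'M[R]_(m, n)) : Prop :=
  forall i j, 0 <= A i j.

Definition semipositive (R : numDomainType) (m n : nat) (A : 'M[R]_(m, n)) : Prop :=
  exists x : 'cV[R]_n, mx_pos x /\ mx_pos (A *m x).

Definition row_positive (R : numDomainType) (m n : nat) (A : 'M[R]_(m, n)) : Prop :=
  mx_nonneg A /\ forall i, exists j, A i j != 0.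

Definition inverse_nonneg (R : numFieldType) (n : nat) (Y : 'M[R]_n) : Prop :=
  Y \in unitmx /\ mx_nonneg (invmx Y).

(* Main.v *)
Require Import Defs.
From HB Require Import structures.
From mathcomp Require Import all_boot all_order all_algebra.
From mathcomp Require Import boolp reals.
From mathcomp Require Import lra.

Set Implicit Arguments.
Unset Strict Implicit.
Unset Printing Implicit Defensive.

Import Order.TTheory GRing.Theory Num.Theory.

Local Open Scope ring_scope.

(** A rank-one matrix is semipositive exactly when it factors as [u *m v] with
    [u > 0] entrywise and [v] having a positive entry. So [L] sends products of
    this kind to products of this kind, and the crux is that for every nonzero
    row vector [v], one of [v] and [- v] has a positive entry: for [u > 0] and
    [v != 0], up to the sign of [v], [L (u *m v)] is of this kind.

    Fix [u > 0] and write row [i] of [L (u *m v)] as [v *m slice i u]. Because a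
    positive column factor makes all rows positive multiples of one another,
    each [slice i u] sends every [v] to a positive multiple of [v *m slice k u];
    in particular the slices are invertible, and a matrix for which every vector
    is an eigenvector is scalar, so [slice i u] is a positive multiple of
    [slice k u] ([slice_proportional]). This already excludes maps of the form
    [A |-> X *m A^T *m Y], without the classification of the linear maps that
    preserve rank one.

    Now let [u] vary. By additivity in [u], two positive vectors have either
    parallel slices or the same ratios between slices
    ([slice_parallel_or_ratio]). If the slices were not all parallel, the ratios
    would be constant, which makes two rows of [L A] proportional for all [A]
    and contradicts surjectivity. So all slices are multiples of one matrix [Y],
    with coefficients linear in [u]; these coefficients form [X] and
    [L A = X *m A *m Y] ([L_mulmx]).

    The sign conditions come from the same description of rank-one semipositive
    matrices applied to [L (u *m v) = (X *m u) *m (v *m Y)]: with [Y] normalised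
    so that [X *m u0 > 0] for one [u0 > 0], the vector [v *m Y] has a positive
    entry whenever [v] does, which means [invmx Y >= 0], and then [X *m u > 0]
    for all [u > 0], which means that [X] is row positive. *)

(** * Semipositive matrices of rank one *)

Lemma mulmx_cVrV (R : nzRingType) (m n : nat) (u : 'cV[R]_m) (v : 'rV[R]_n) i j :
  (u *m v) i j = u i 0 * v 0 j.
Proof. by rewrite mxE big_ord1. Qed.

Section RankOne.
Variables (R : realFieldType) (m n : nat).
Implicit Types (u : 'cV[R]_m) (v : 'rV[R]_n).

(** The witness is the all-ones vector with its [j]-th entry raised by [t], which
    brings [v *m x] up to [s + |s| + 1 > 0] whatever the other entries of [v]. *)
Lemma semipositive_outer u v j :
  mx_pos u -> 0 < v 0 j -> semipositive (u *m v).
Proof.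
move=> u_gt0 vj_gt0; pose s := \sum_k v 0 k.
pose t := (`|s| + 1) / v 0 j.
have t_gt0 : 0 < t by rewrite divr_gt0 // ltr_wpDl.
exists (\col_k (1 + t *+ (k == j))); split=> [k l|i l].
  by rewrite mxE ltr_pwDl // mulrn_wge0 // ltW.
rewrite ord1 -mulmxA mulmx_cVrV mulr_gt0 // mxE.
have -> : \sum_k v 0 k * (\col_k (1 + t *+ (k == j))) k 0 = s + t * v 0 j.
  under eq_bigr => k _ do rewrite mxE mulrDr mulr1 mulrnAr mulrb.
  by rewrite big_split /= -big_mkcond big_pred1_eq mulrC.
rewrite divfK ?gt_eqF //; have := ler_norm (- s); rewrite normrN; lra.
Qed.

Lemma rank_outer u v i j : u i 0 != 0 -> v 0 j != 0 -> \rank (u *m v) = 1%N.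
Proof.
move=> ui vj; apply/eqP; rewrite eqn_leq (leq_trans (mxrankM_maxl _ _)) ?rank_leq_col //=.
rewrite lt0n mxrank_eq0; apply/negP=> /eqP/matrixP/(_ i j)/eqP.
by rewrite mulmx_cVrV mxE mulf_eq0 (negPf ui) (negPf vj).
Qed.

(** Semipositivity forces the column factor of a rank-one matrix to have all
    its entries nonzero and of one sign; that sign is moved to the row factor. *)
Lemma semipositive_rank1_factor (M : 'M[R]_(m, n)) (i0 : 'I_m) :
  \rank M = 1%N -> semipositive M ->
  exists p : 'cV[R]_m, exists2 q : 'rV[R]_n,
    M = p *m q & mx_pos p /\ exists j, 0 < q 0 j.
Proof.
move=> rM [x [x_gt0 Mx_gt0]].
have [c [r Mcr]] : exists c : 'cV[R]_m, exists r : 'rV[R]_n, M = c *m r.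
  by move: (col_base M) (row_base M) (mulmx_base M); rewrite rM => c r <-; exists c, r.
pose a := (r *m x) 0 0.
have ca_gt0 i : 0 < c i 0 * a.
  by have := Mx_gt0 i 0; rewrite Mcr -mulmxA mulmx_cVrV.
have a_neq0 : a != 0 by apply: contraTneq (ca_gt0 i0) => ->; rewrite mulr0 ltxx.
exists (a *: c), (a^-1 *: r).
  by rewrite -scalemxAl -scalemxAr scalerA divff // scale1r.
split=> [i j|]; first by rewrite ord1 mxE mulrC.
apply/existsP; apply: contraT; rewrite negb_exists => /forallP q_le0.
have : a^-1 * a <= 0.
  rewrite {2}/a mxE big_distrr /= sumr_le0 // => k _.
  have := q_le0 k; rewrite mxE -leNgt mulrA => qk.
  by rewrite mulr_le0_ge0 // ltW.
by rewrite mulVf // ler10.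
Qed.

End RankOne.

(** * Two principles of linear algebra *)

(** The positive vectors span: every vector becomes positive after adding a
    large multiple of the all-ones vector. *)
Lemma linear_eq_on_pos (R : realFieldType) (m : nat) (V : lmodType R)
    (f g : 'cV[R]_m -> V) : linear f -> linear g ->
  (forall u, mx_pos u -> f u = g u) -> f =1 g.
Proof.
move=> f_lin g_lin fg u; pose c : R := 1 + \sum_i `|u i 0|.
have c_ge i : `|u i 0| < c.
  by rewrite /c (bigD1 i) //= addrCA ltrDl ltr_wpDr // sumr_ge0.
have c_gt0 : 0 < c by rewrite /c ltr_pwDl // sumr_ge0.
have -> : u = (-1) *: const_mx c + (u + const_mx c) by rewrite scaleN1r addrC addrK.
rewrite f_lin g_lin !fg // => i j; rewrite !mxE // ord1.
by have := c_ge i; rewrite ltr_norml; lra.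
Qed.

(** Apply the hypothesis to a sum of two basis vectors: their eigenvalues agree. *)
Lemma scalar_mx_of_eigen (F : fieldType) (n : nat) (j0 : 'I_n) (C : 'M[F]_n) :
  (forall v : 'rV_n, exists a, v *m C = a *: v) -> C = (C j0 j0)%:M.
Proof.
move=> eigC.
have entry (v : 'rV_n) : exists a, forall k, (v *m C) 0 k = a * v 0 k.
  by have [a /rowP va] := eigC v; exists a => k; rewrite va mxE.
have offdiag i k : k != i -> C i k = 0.
  have [a /(_ k)] := entry (delta_mx 0 i).
  by rewrite -rowE !mxE eqxx /= => -> /negPf->; rewrite mulr0.
apply/matrixP => i k; rewrite !mxE eq_sym.
have [->|/offdiag //] := eqVneq; have [->//|ij] := eqVneq i j0.
have [a Ha] := entry (delta_mx 0 i + delta_mx 0 j0).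
have := Ha i; have := Ha j0; rewrite mulmxDl -!rowE !mxE !eqxx /= [j0 == i]eq_sym.
rewrite (negPf ij) (offdiag i j0) 1?eq_sym // (offdiag j0 i) //.
by rewrite !addr0 !add0r => -> ->.
Qed.

(** * Slices of a map on matrices *)

Section Preserver.
Variables (R : realFieldType) (m n : nat).
Variable L : {linear 'M[R]_(m, n) -> 'M[R]_(m, n)}.
Implicit Types (u : 'cV[R]_m) (v : 'rV[R]_n) (i : 'I_m).

(** The row vector [row i (L (u *m v))] is bilinear in [u] and [v]; this is its
    matrix in [v], for fixed [i] and [u]. *)
Definition slice i u : 'M[R]_n := \matrix_j row i (L (u *m delta_mx 0 j)).

Lemma mul_slice v i u : v *m slice i u = row i (L (u *m v)).
Proof.
rewrite [in RHS](row_sum_delta v) mulmx_sumr linear_sum /=.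
rewrite linear_sum mulmx_sum_row; apply: eq_bigr => j _ /=.
by rewrite rowK -scalemxAr !linearZ.
Qed.

Lemma sliceE v i u k : (v *m slice i u) 0 k = L (u *m v) i k.
Proof. by rewrite mul_slice mxE. Qed.

Lemma slice_linear i : linear (slice i).
Proof.
move=> a u u'; apply/row_matrixP => j; rewrite linearP /= !rowK.
by rewrite mulmxDl -scalemxAl !linearP.
Qed.

Lemma row_sum_slice i A :
  row i (L A) = \sum_k row k A *m slice i (delta_mx k 0).
Proof.
have {1}-> : A = \sum_k delta_mx k 0 *m row k A.
  apply/matrixP => l j; rewrite summxE (bigD1 l) //= mulmx_cVrV !mxE !eqxx mul1r.
  rewrite big1 ?addr0 // => k /negPf kl.
  by rewrite mulmx_cVrV [delta_mx _ _ _ _]mxE eq_sym kl mul0r.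
by rewrite !linear_sum /=; apply: eq_bigr => k _; rewrite mul_slice.
Qed.

Hypothesis L_factor : forall u v j, mx_pos u -> 0 < v 0 j ->
  exists p : 'cV[R]_m, exists2 q : 'rV[R]_n,
    L (u *m v) = p *m q & mx_pos p /\ exists k, 0 < q 0 k.

(** This is where semipositivity rules out the transpose-like behaviour: of a
    nonzero [v] and its opposite one has a positive entry, so the column factor
    of [L (u *m v)] never vanishes anywhere as [v] runs over the nonzero rows. *)
Lemma slice_ratio u v i k : mx_pos u -> v != 0 ->
  v *m slice k u != 0 /\ exists2 a, 0 < a & v *m slice i u = a *: (v *m slice k u).
Proof.
move=> u_gt0 v_neq0.
wlog [j vj_gt0] : v v_neq0 / exists j, 0 < v 0 j => [wl|].
  have /rV0Pn[j] := v_neq0; rewrite neq_lt => /orP[vj|vj]; last first.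
    by apply: wl => //; exists j.
  have [||] := wl (- v); first by rewrite oppr_eq0.
    by exists j; rewrite mxE oppr_gt0.
  rewrite !mulNmx oppr_eq0 => ? [a a_gt0 /eqP]; rewrite scalerN eqr_opp => /eqP.
  by split=> //; exists a.
have [p [q Lpq [p_gt0 [l ql_gt0]]]] := L_factor u_gt0 vj_gt0.
rewrite !mul_slice Lpq; split.
  by apply/rV0Pn; exists l; rewrite mxE mulmx_cVrV mulf_neq0 ?gt_eqF.
exists (p i 0 / p k 0); first by rewrite divr_gt0.
apply/rowP => j'; rewrite !mxE !big_ord1 mulrA divfK ?gt_eqF //.
Qed.

Lemma slice_unit u k : mx_pos u -> slice k u \in unitmx.
Proof.
move=> u_gt0; rewrite -row_free_unit; apply/inj_row_free => v vS0.
by apply/eqP; apply: contraPT vS0 => /(slice_ratio k k u_gt0)[/eqP].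
Qed.

Lemma slice_neq0 u k (j0 : 'I_n) : mx_pos u -> slice k u != 0.
Proof.
move=> u_gt0; apply: contraTneq (slice_unit k u_gt0) => ->.
rewrite -row_free_unit -kermx_eq0; apply/rowV0Pn; exists (delta_mx 0 j0).
  by apply/sub_kermxP; rewrite mulmx0.
by apply/rV0Pn; exists j0; rewrite mxE !eqxx oner_eq0.
Qed.

(** With [slice k u] inverted, every vector is an eigenvector of
    [invmx (slice k u) *m slice i u]. *)
Lemma slice_proportional u i k (j0 : 'I_n) : mx_pos u ->
  exists2 a, 0 < a & slice i u = a *: slice k u.
Proof.
move=> u_gt0; have Su := slice_unit k u_gt0.
pose C := invmx (slice k u) *m slice i u.
have defS : slice i u = C j0 j0 *: slice k u.
  have eigC v : exists a, v *m C = a *: v.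
    have [->|v_neq0] := eqVneq v 0; first by exists 0; rewrite mul0mx scaler0.
    have w_neq0 : v *m invmx (slice k u) != 0.
      by apply: contraNneq v_neq0 => w0; rewrite -(mulmxKV Su v) w0 mul0mx.
    have [_ [a _]] := slice_ratio i k u_gt0 w_neq0.
    by rewrite mulmxKV // -mulmxA => ?; exists a.
  by rewrite -mul_mx_scalar -(scalar_mx_of_eigen j0 eigC) mulKVmx.
exists (C j0 j0) => //.
have dj0 : delta_mx 0 j0 != 0 :> 'rV[R]_n.
  by apply/rV0Pn; exists j0; rewrite mxE !eqxx oner_eq0.
have [w_neq0 [a a_gt0]] := slice_ratio i k u_gt0 dj0.
rewrite defS -scalemxAr => /eqP; rewrite -subr_eq0 -scalerBl scaler_eq0 (negPf w_neq0).
by rewrite orbF subr_eq0 => /eqP->.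
Qed.

(** Additivity of [slice i] and [slice k] at [u + u'] gives a linear relation
    between [slice k u] and [slice k u'] which is trivial only when the three
    ratios at [u], [u'] and [u + u'] coincide. *)
Lemma slice_parallel_or_ratio u u' i k (j0 : 'I_n) a : mx_pos u -> mx_pos u' ->
  slice i u = a *: slice k u ->
  (exists c, slice k u' = c *: slice k u) \/ slice i u' = a *: slice k u'.
Proof.
move=> u_gt0 u'_gt0 ua.
have uu'_gt0 : mx_pos (u + u') by move=> x y; rewrite mxE addr_gt0.
have [b _ u'b] := slice_proportional i k j0 u'_gt0.
have [c _] := slice_proportional i k j0 uu'_gt0.
rewrite -[u]scale1r !slice_linear !scale1r ua u'b scalerDr => rel.
have {}rel : (a - c) *: slice k u = (c - b) *: slice k u'.
  by apply/eqP; rewrite !scalerBl subr_eq addrAC eq_sym subr_eq rel addrC.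
have [cb|cb] := eqVneq c b; [right | left].
  move/eqP: rel; rewrite cb subrr scale0r scaler_eq0 (negPf (slice_neq0 k j0 u_gt0)).
  by rewrite orbF subr_eq0 => /eqP->.
exists ((c - b)^-1 * (a - c)).
by rewrite -scalerA rel scalerA mulVf ?scale1r // subr_eq0.
Qed.

Hypothesis L_surj : forall B, exists A, L A = B.

(** Were [slice i0 u] and [slice i0 u'] independent, no third slice could be
    parallel to both, so all the ratios of [slice i1] to [slice i0] would agree
    and row [i1] of every [L A] would be the same multiple of row [i0]. *)
Lemma slice_parallel u u' i0 i1 (j0 : 'I_n) : i0 != i1 ->
  mx_pos u -> mx_pos u' -> exists c, slice i0 u' = c *: slice i0 u.
Proof.
move=> i01 u_gt0 u'_gt0; apply: contrapT => not_par.
have [a _ ua] := slice_proportional i1 i0 j0 u_gt0.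
have u'a : slice i1 u' = a *: slice i0 u'.
  by have [] := slice_parallel_or_ratio j0 u_gt0 u'_gt0 ua.
have allpos w : mx_pos w -> slice i1 w = a *: slice i0 w.
  move=> w_gt0.
  have [[c wc]|//] := slice_parallel_or_ratio j0 u_gt0 w_gt0 ua.
  have [[d wd]|//] := slice_parallel_or_ratio j0 u'_gt0 w_gt0 u'a.
  case: not_par; exists (d^-1 * c); rewrite -scalerA -wc wd scalerA mulVf ?scale1r //.
  by apply: contraNneq (slice_neq0 i0 j0 w_gt0) => d0; rewrite wd d0 scale0r.
have all w : slice i1 w = a *: slice i0 w.
  apply: (linear_eq_on_pos (slice_linear i1) (g := fun w => a *: slice i0 w)) => //.
  by move=> b x y; rewrite slice_linear scalerDr !scalerA mulrC.
have [A LA] := L_surj (delta_mx i1 j0).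
have : row i1 (L A) = a *: row i0 (L A).
  by rewrite !row_sum_slice scaler_sumr; apply: eq_bigr => k _; rewrite all scalemxAr.
move=> /rowP/(_ j0)/eqP.
by rewrite LA !mxE !eqxx (negPf i01) mulr0 oner_eq0.
Qed.

(** As all slices at positive vectors are parallel, any one of them serves as
    [Y]; the coefficient of [slice i u] along it is linear in [u] and gives [X].
    The positive vector with positive image records that the common sign of [X]
    and [Y], which the equation alone leaves free, is the right one. *)
Lemma L_mulmx i0 i1 (j0 : 'I_n) : i0 != i1 ->
  exists X : 'M[R]_m, exists2 Y : 'M[R]_n, Y \in unitmx &
    (forall A, L A = X *m A *m Y) /\ exists2 u : 'cV[R]_m, mx_pos u & mx_pos (X *m u).
Proof.
move=> i01; pose u0 : 'cV[R]_m := const_mx 1.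
have u0_gt0 : mx_pos u0 by move=> i j; rewrite mxE.
pose Y := slice i0 u0; have Yu : Y \in unitmx by apply: slice_unit.
pose x i u := (slice i u *m invmx Y) j0 j0.
have xE i u a : slice i u = a *: Y -> x i u = a.
  by move=> sa; rewrite /x sa -scalemxAl mulmxV // !mxE eqxx mulr1.
have x_lin i b u u' : x i (b *: u + u') = b * x i u + x i u'.
  by rewrite /x slice_linear mulmxDl -scalemxAl mxE [in X in X + _]mxE.
have sliceY i u : slice i u = x i u *: Y.
  apply: (linear_eq_on_pos (slice_linear i) (g := fun u => x i u *: Y)).
    by move=> b w w'; rewrite x_lin scalerDl scalerA.
  move=> w w_gt0; have [a _ wa] := slice_proportional i i0 j0 w_gt0.
  have [c wc] := slice_parallel j0 i01 u0_gt0 w_gt0.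
  by rewrite {1}wa wc scalerA (xE _ _ (a * c)) // wa wc scalerA.
pose X := \matrix_(i, k) x i (delta_mx k 0).
have LE A : L A = X *m A *m Y.
  apply/row_matrixP => i; rewrite row_sum_slice -mulmxA row_mul mulmx_sum_row.
  apply: eq_bigr => k _.
  by rewrite sliceY -scalemxAr row_mul !mxE.
exists X, Y => //; split=> //; exists u0 => // i j.
(* Read off the entry of [L (u0 *m v)] for the [v] that [Y] sends to a basis vector. *)
have -> : (X *m u0) i j = x i u0.
  rewrite ord1 -[LHS]mulr1 -[X in _ * X](_ : (delta_mx 0 j0 : 'rV[R]_n) 0 j0 = 1).
    by rewrite -mulmx_cVrV -[delta_mx 0 j0](mulmxKV Yu) mulmxA -[X *m u0 *m _]mulmxA
      -LE -sliceE sliceY -scalemxAr mulmxKV // !mxE !eqxx mulr1.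
  by rewrite mxE !eqxx.
have [a a_gt0 ua] := slice_proportional i i0 j0 u0_gt0.
by rewrite (xE _ _ a).
Qed.

End Preserver.

(** * Sign conditions *)

(** A negative entry [X i j] could be compensated exactly: moving from the
    all-ones vector along the [j]-th basis vector until row [i] vanishes stays
    inside the positive vectors. *)
Lemma row_positive_of_pos (R : realFieldType) (m n : nat) (X : 'M[R]_(m, n)) :
  (forall u : 'cV_n, mx_pos u -> mx_pos (X *m u)) -> row_positive X.
Proof.
move=> Xpos; pose e : 'cV[R]_n := const_mx 1.
have e_gt0 : mx_pos e by move=> i j; rewrite mxE.
have Xe_gt0 i : 0 < (X *m e) i 0 by apply: Xpos.
split=> i; last first.
  apply/existsP; apply: contraT; rewrite negb_exists => /forallP Xi0.
  have := Xe_gt0 i; rewrite mxE big1 ?ltxx // => j _.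
  by have := Xi0 j; rewrite negbK => /eqP->; rewrite mul0r.
move=> j; rewrite leNgt; apply/negP => Xij_lt0.
pose t := (X *m e) i 0 / - X i j.
have t_gt0 : 0 < t by rewrite divr_gt0 // oppr_gt0.
have : mx_pos (X *m (e + t *: delta_mx j 0)).
  by apply: Xpos => k l; rewrite !mxE ltr_pwDl // mulr_ge0 ?ler0n // ltW.
suff X0 : (X *m (e + t *: delta_mx j 0)) i 0 = 0 by move=> /(_ i 0); rewrite X0 ltxx.
rewrite mulmxDr -scalemxAr -colE [LHS]mxE [X in _ + X]mxE [col _ _ _ _]mxE.
by rewrite /t invrN mulrN mulNr divfK ?lt_eqF // subrr.
Qed.

(** If [v *m Y <= 0] forces [v <= 0], testing on the opposite of each row of
    [invmx Y] shows that this row is nonnegative. *)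
Lemma inverse_nonneg_of_pos_entry (R : realFieldType) (n : nat) (Y : 'M[R]_n) :
  Y \in unitmx ->
  (forall (v : 'rV_n) j, 0 < v 0 j -> exists k, 0 < (v *m Y) 0 k) ->
  inverse_nonneg Y.
Proof.
move=> Yu Ypos; split=> // i j; rewrite leNgt; apply/negP => Yij_lt0.
have [|k] := Ypos (- row i (invmx Y)) j; first by rewrite !mxE oppr_gt0.
by rewrite mulNmx -row_mul mulVmx // !mxE oppr_gt0 ltrn0.
Qed.

Lemma unitmx_of_injective_mul (F : fieldType) (m n : nat) (j0 : 'I_n)
    (X : 'M[F]_m) (Y : 'M[F]_n) :
  injective (fun A : 'M_(m, n) => X *m A *m Y) -> X \in unitmx.
Proof.
move=> inj; rewrite -unitmx_tr -row_free_unit; apply/inj_row_free => v vX0.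
have : v^T *m (delta_mx 0 j0 : 'rV_n) = 0.
  apply: inj; rewrite mulmxA mulmx0 -[X]trmxK -trmx_mul vX0.
  by rewrite trmx0 !mul0mx.
move=> /matrixP vd; apply/rowP => i; have := vd i j0.
by rewrite mulmx_cVrV !mxE !eqxx mulr1.
Qed.

Theorem theorem3p1 (R : realType) (m n : nat) (hn : (2 <= n)%N) (hmn : (n <= m)%N)
  (L : {linear 'M[R]_(m, n) -> 'M[R]_(m, n)}) (hL : bijective L)
  (hS : forall A : 'M[R]_(m, n), semipositive A -> semipositive (L A))
  (hrank : forall A : 'M[R]_(m, n),
     \rank A = 1%N -> semipositive A -> \rank (L A) = 1%N) :
  exists (X : 'M[R]_m) (Y : 'M[R]_n),
    [/\ X \in unitmx, row_positive X, inverse_nonneg Y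
      & forall A : 'M[R]_(m, n), L A = X *m A *m Y].
Proof.
pose i0 : 'I_m := Ordinal (leq_trans (ltnW hn) hmn).
pose i1 : 'I_m := Ordinal (leq_trans hn hmn).
pose j0 : 'I_n := Ordinal (ltnW hn).
have L_factor (u : 'cV[R]_m) (v : 'rV[R]_n) j : mx_pos u -> 0 < v 0 j ->
    exists p : 'cV[R]_m, exists2 q : 'rV[R]_n,
      L (u *m v) = p *m q & mx_pos p /\ exists k, 0 < q 0 k.
  move=> u_gt0 vj_gt0; have uv_sp := semipositive_outer u_gt0 vj_gt0.
  apply: (semipositive_rank1_factor i0); last exact: hS.
  by apply: hrank => //; apply: (@rank_outer _ _ _ u v i0 j); rewrite gt_eqF.
have L_surj B : exists A, L A = B by have [K _ LK] := hL; exists (K B).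
have i01 : i0 != i1 by [].
have [X [Y Yu [LE [u0 u0_gt0 Xu0_gt0]]]] := L_mulmx L_factor L_surj j0 i01.
have LuvE (u : 'cV_m) (v : 'rV_n) i k :
    L (u *m v) i k = (X *m u) i 0 * (v *m Y) 0 k.
  by rewrite LE mulmxA -mulmxA mulmx_cVrV.
have Ypos (v : 'rV_n) j : 0 < v 0 j -> exists k, 0 < (v *m Y) 0 k.
  move=> vj_gt0; have [p [q Lpq [p_gt0 [k qk_gt0]]]] := L_factor _ _ _ u0_gt0 vj_gt0.
  exists k; have : 0 < L (u0 *m v) i0 k by rewrite Lpq mulmx_cVrV mulr_gt0.
  by rewrite LuvE pmulr_rgt0.
have Yinv := inverse_nonneg_of_pos_entry Yu Ypos.
exists X, Y; split=> //.
  apply: (unitmx_of_injective_mul (Y := Y) j0) => A B; rewrite -!LE.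
  exact: (bij_inj hL).
apply: row_positive_of_pos => u u_gt0 i j; rewrite {j}ord1.
(* This row vector is nonnegative, and its image under [Y] has a single nonzero
   entry, which therefore has to carry the positive entry of the row factor. *)
pose v := row j0 (invmx Y).
have vY : v *m Y = delta_mx 0 j0 by rewrite -row_mul mulVmx // row1.
have [j vj_gt0] : exists j, 0 < v 0 j.
  have /rV0Pn[j vj] : v != 0.
    apply/eqP => v0; move/rowP/(_ j0)/eqP: vY.
    by rewrite v0 mul0mx !mxE !eqxx eq_sym oner_eq0.
  by exists j; rewrite lt_neqAle eq_sym vj mxE; apply: Yinv.2.
have [p [q Lpq [p_gt0 [k qk_gt0]]]] := L_factor _ _ _ u_gt0 vj_gt0.
have : 0 < L (u *m v) i k by rewrite Lpq mulmx_cVrV mulr_gt0.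
rewrite LuvE vY [delta_mx _ _ _ _]mxE eqxx /=.
by case: (k == j0); rewrite ?mulr1 // mulr0 ltxx.
Qed.
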